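(* Let $\Phi$ be a multiplicative distance function and $N\ge1$. Then \[ \lambda_{N+1}(\mathcal{U}_N(\Phi))=2\widehat{f_N}(\Phi;N+1)\quad\text{and}\quad \lambda_{2N+2}(\mathcal{V}_N(\Phi))=2\pi\,\widehat{h_N}(\Phi;2N+2). \]
   Context: A multiplicative distance function is a function $\Phi:\mathbb{C}[x]\to[0,\infty)$ which is continuous on every finite-dimensional subspace of $\mathbb{C}[x]$ (as a function of coefficient vectors), satisfies $\Phi(f)=0$ iff $f=0$, $\Phi(wf)=|w|\Phi(f)$ for $w\in\mathbb{C}$, and $\Phi(fg)=\Phi(f)\Phi(g)$. For $\mathbf{a}\in\mathbb{C}^{N+1}$ write $\Phi(\mathbf{a})=\Phi\big(\sum_{n=1}^{N+1}a_nx^{N+1-n}\big)$; $\mathcal{U}_N(\Phi)=\{\mathbf{a}\in\mathbb{R}^{N+1}:\Phi(\mathbf{a})\le1\}$, $\mathcal{V}_N(\Phi)=\{\mathbf{a}\in\mathbb{C}^{N+1}:\Phi(\mathbf{a})\le1\}$. With $\widetilde\Phi(\mathbf{b})=\Phi\big(x^N+\sum_{n=1}^Nb_nx^{N-n}\big)$ for $\mathbf{b}\in\mathbb{C}^N$, let $f_N(\Phi;\xi)=\lambda_N\{\mathbf{b}\in\mathbb{R}^N:\widetilde\Phi(\mathbf{b})\le\xi\}$, $h_N(\Phi;\xi)=\lambda_{2N}\{\mathbf{b}\in\mathbb{C}^N:\widetilde\Phi(\mathbf{b})\le\xi\}$ ($\lambda_k$ is Lebesgue measure), and define the Mellin transforms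 $\widehat{f_N}(\Phi;s)=\int_0^\infty\xi^{-s}f_N(\Phi;\xi)\,\frac{d\xi}{\xi}$ (convergent for $\Re s>N$) and $\widehat{h_N}(\Phi;s)=\int_0^\infty\xi^{-s}h_N(\Phi;\xi)\,\frac{d\xi}{\xi}$ (convergent for $\Re s>2N$). *)

(* Defs.v *)
From HB Require Import structures.
From mathcomp Require Import all_boot all_order all_algebra.
From mathcomp Require Import all_classical all_reals all_analysis.
From mathcomp Require Import complex.

Set Implicit Arguments.
Unset Strict Implicit.
Unset Printing Implicit Defensive.

Import Order.TTheory GRing.Theory Num.Theory.
Import numFieldNormedType.Exports.

Local Open Scope classical_set_scope.
Local Open Scope ring_scope.
Local Open Scope complex_scope.

Section cons_measure.
Context d (T : measurableType d) (R : realType) (n : nat).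
Variables (m : {sigma_finite_measure set T -> \bar R})
  (mu : {sigma_finite_measure set (n.-tuple T) -> \bar R}).

Definition cons_pair (p : T * n.-tuple T) : n.+1.-tuple T :=
  [tuple of p.1 :: p.2].

Lemma measurable_cons_pair : measurable_fun [set: T * n.-tuple T] cons_pair.
Proof. exact: (measurable_cons measurable_fst measurable_snd). Qed.

Definition cons_measure : set (n.+1.-tuple T) -> \bar R :=
  pushforward (m \x mu)%E cons_pair.

Let cons_pre A : measurable A -> measurable (cons_pair @^-1` A).
Proof.
by move=> mA; rewrite -[X in measurable X]setTI; exact: measurable_cons_pair.
Qed.

Let cons_measure0 : cons_measure set0 = 0%E.
Proof. by rewrite /cons_measure /pushforward preimage_set0 measure0. Qed.

Let cons_measure_ge0 A : (0 <= cons_measure A)%E.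
Proof. by rewrite /cons_measure /pushforward measure_ge0. Qed.

Let cons_measure_sigma_additive : semi_sigma_additive cons_measure.
Proof.
move=> F mF tF mUF; rewrite /cons_measure /pushforward preimage_bigcup.
apply: measure_semi_sigma_additive.
- by move=> k; exact: cons_pre.
- apply/trivIsetP => /= i j _ _ ij; rewrite -preimage_setI.
  by move/trivIsetP : tF => /(_ _ _ _ _ ij) ->//; rewrite preimage_set0.
- by rewrite -preimage_bigcup; exact: cons_pre.
Qed.

HB.instance Definition _ := isMeasure.Build _ _ _ cons_measure
  cons_measure0 cons_measure_ge0 cons_measure_sigma_additive.

Let cons_measure_sigma_finite : sigma_finite setT cons_measure.
Proof.
have /sigma_finiteP[F [FT ndF Foo]] := sigma_finiteT m.
have /sigma_finiteP[G [GT ndG Goo]] := sigma_finiteT mu.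
pose uncons (t : n.+1.-tuple T) : T * n.-tuple T :=
  (thead t, [tuple of behead t]).
have munc : measurable_fun [set: n.+1.-tuple T] uncons.
  by apply: measurable_fun_pair; [exact: measurable_tnth
                                 |exact: measurable_behead].
have consK : cancel cons_pair uncons.
  by case=> x t; congr pair => //; apply: val_inj.
exists (fun k => uncons @^-1` (F k `*` G k)).
  rewrite -preimage_bigcup (_ : \bigcup_i _ = setT) ?preimage_setT//.
  apply/seteqP; split=> // -[x t] _.
  have [i _ Fix] : (\bigcup_i F i) x by rewrite -FT.
  have [j _ Gjt] : (\bigcup_i G i) t by rewrite -GT.
  exists (maxn i j) => //; split.
  - by move: x Fix; exact/subsetPset/ndF/leq_maxl.
  - by move: t Gjt; exact/subsetPset/ndG/leq_maxr.
move=> k; have [mFk Fkoo] := Foo k; have [mGk Gkoo] := Goo k; split.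
  by rewrite -[X in measurable X]setTI; apply: munc => //; exact: measurableX.
rewrite /cons_measure /pushforward -comp_preimage.
rewrite (_ : uncons \o cons_pair = id); last exact/funext.
by rewrite preimage_id product_measure1E// lte_mul_pinfty// ge0_fin_numE.
Qed.

HB.instance Definition _ := Measure_isSigmaFinite.Build _ _ _ cons_measure
  cons_measure_sigma_finite.

End cons_measure.

Section lebesgue_tuple.
Variable R : realType.
Local Notation T := (measurableTypeR R).

Let dirac_nil_fin :
  fin_num_fun (\d_([tuple] : 0.-tuple T) : set (0.-tuple T) -> \bar R).
Proof. by move=> A mA; rewrite diracE. Qed.

Definition lebesgue_tuple0 : set (0.-tuple T) -> \bar R := \d_[tuple].

HB.instance Definition _ := Measure.on lebesgue_tuple0.
HB.instance Definition _ := Measure_isFinite.Build _ _ _ lebesgue_tuple0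
  dirac_nil_fin.

(* Borel Lebesgue measure on R^n, as an iterated product of [lebesgue_measure];
   see [lebesgue_tuple_box] for its values on boxes. *)
Fixpoint lebesgue_tuple (n : nat) :
    {sigma_finite_measure set (n.-tuple T) -> \bar R} :=
  match n with
  | 0 => lebesgue_tuple0
  | n'.+1 => cons_measure (@lebesgue_measure R) (lebesgue_tuple n')
  end.

Lemma lebesgue_tuple_box (n : nat) (A : 'I_n -> set T) :
  (forall i, measurable (A i)) ->
  lebesgue_tuple n [set t | forall i, A i (tnth t i)] =
  (\prod_(i < n) lebesgue_measure (A i))%E.
Proof.
elim: n A => [|n IHn] A mA /=.
  by rewrite big_ord0 /lebesgue_tuple0 diracE mem_set//= => -[].
rewrite big_ord_recl -IHn; last by move=> i; exact: mA.
rewrite /cons_measure /pushforward -product_measure1E//; last first.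
  rewrite (_ : mkset _ = \bigcap_(i in [set: 'I_n])
    ((fun t : n.-tuple T => tnth t i) @^-1` A (lift ord0 i))).
    apply: fin_bigcap_measurable => // i _; rewrite -[X in measurable X]setTI.
    exact: (measurable_tnth i).
  by apply/seteqP; split => t At i => [_|]; exact: At.
congr (product_measure1 _ _ _); apply/seteqP; split => -[x t] /=.
  move=> At; split; first by have := At ord0; rewrite tnth0.
  by move=> i; have := At (lift ord0 i); rewrite tnthS.
move=> -[Ax At] i; case: (unliftP ord0 i) => [j ->|->].
  by rewrite tnthS; exact: At.
by rewrite tnth0.
Qed.

End lebesgue_tuple.

Section multiplicative_distance.
Variable R : realType.
Local Notation C := R[i].

(* A finite-dimensional subspace of C[x] is given by a finite spanning family
   [v]; [R[i]^o] is the complex plane with the topology of its norm. *)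
Record multiplicative_distance (Phi : {poly C} -> R) : Prop := {
  mdist_ge0 : forall f, 0 <= Phi f;
  mdist_continuous : forall (n : nat) (v : 'I_n -> {poly C}),
    continuous (fun a : 'rV[C^o]_n =>
      Phi (\sum_(i < n) (a ord0 i : C) *: v i));
  mdist_eq0 : forall f, Phi f = 0 <-> f = 0;
  mdistZ : forall (w : C) f, Phi (w *: f) = Normc.normc w * Phi f;
  mdistM : forall f g, Phi (f * g) = Phi f * Phi g }.

Variables (N : nat) (Phi : {poly C} -> R).

(* Indices are shifted by one: [tnth a i] is the coefficient a_(i+1). *)
Definition vec_poly (a : N.+1.-tuple C) : {poly C} :=
  \sum_(i < N.+1) tnth a i *: 'X^(N - i).

Definition monic_vec_poly (b : N.-tuple C) : {poly C} :=
  'X^N + \sum_(i < N) tnth b i *: 'X^(N - i.+1).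

Definition Phi_vec (a : N.+1.-tuple C) : R := Phi (vec_poly a).

Definition Phi_tilde (b : N.-tuple C) : R := Phi (monic_vec_poly b).

Definition realvec (n : nat) (a : n.-tuple R) : n.-tuple C :=
  [tuple of map (fun x : R => x%:C) a].

(* The identification of R^(2n) with C^n: coordinates 2j and 2j + 1 are the
   real and imaginary parts of the j-th complex coordinate. *)
Definition complexvec (n : nat) (a : n.*2.-tuple R) : n.-tuple C :=
  [tuple nth 0 a j.*2 +i* nth 0 a j.*2.+1 | j < n].

Definition lebesgue_ctuple (n : nat) (A : set (n.-tuple C)) : \bar R :=
  lebesgue_tuple R n.*2 (@complexvec n @^-1` A).

Definition U_N : set (N.+1.-tuple R) :=
  [set a | Phi_vec (realvec a) <= 1].

Definition V_N : set (N.+1.-tuple C) := [set a | Phi_vec a <= 1].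

Definition f_N (xi : R) : \bar R :=
  lebesgue_tuple R N [set b : N.-tuple R | Phi_tilde (realvec b) <= xi].

Definition h_N (xi : R) : \bar R :=
  lebesgue_ctuple [set b : N.-tuple C | Phi_tilde b <= xi].

End multiplicative_distance.
Arguments U_N {R} N Phi.
Arguments V_N {R} N Phi.
Arguments f_N {R} N Phi xi.
Arguments h_N {R} N Phi xi.

(* The Mellin transform with kernel xi^(-s) and measure d xi / xi, at a real
   argument s, of a function with values in [0, +oo]; the integral is +oo when
   it diverges. *)
Definition mellin (R : realType) (f : R -> \bar R) (s : R) : \bar R :=
  (\int[@lebesgue_measure R]_(xi in `]0%R, +oo[)
     ((xi `^ (- s))%:E * f xi * (xi^-1)%:E))%E.

(* Main.v *)
(** Slice the star body along the leading coefficient [w]. Homogeneity of [Phi]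
    and the change of variable [t = w b] turn the slice over [w <> 0] into
    [|w|^(d N)] times the volume of [{b | |w| Phi~(b) <= 1}], where [d = 1] over
    the reals and [d = 2] over the complex numbers. Exchanging the order of
    integration, everything reduces to the radial integral
    [int_{|w| <= rho} |w|^(d N) dw = K d / s * rho^s] with [s = d (N + 1)] and
    [K] the measure of the unit ball of the line or plane ([K = 2] or [K = pi]),
    at [rho = 1 / Phi~(b)]. On the other side, Tonelli turns the Mellin
    transform at [s] into the integral over [b] of [Phi~(b)^(-s) / s]; the two
    differ by the factor [K d]. *)
From HB Require Import structures.
From mathcomp Require Import all_boot all_order all_algebra.
From mathcomp Require Import all_classical all_reals all_analysis.
From mathcomp Require Import measurable_realfun complex ring lra.
Require Import Defs.

Set Implicit Arguments.
Unset Strict Implicit.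
Unset Printing Implicit Defensive.

Import Order.TTheory GRing.Theory Num.Theory.
Import numFieldNormedType.Exports.

Local Open Scope classical_set_scope.
Local Open Scope ring_scope.

Lemma measurable_set_bool d (T : measurableType d) (f : T -> bool) :
  measurable_fun setT f -> measurable [set x | f x].
Proof.
move=> mf; rewrite -[X in measurable X]setTI.
exact: (mf measurableT [set true]).
Qed.
(** * Linear changes of variables *)

Lemma ge0_iterated_integralZl d1 d2 (T1 : measurableType d1)
    (T2 : measurableType d2) (R : realType)
    (m1 : {sigma_finite_measure set T1 -> \bar R})
    (m2 : {sigma_finite_measure set T2 -> \bar R})
    (k : R) (f : T1 * T2 -> \bar R) :
  measurable_fun setT f -> (forall z, 0 <= f z)%E -> 0 <= k ->
  (\int[m1]_x \int[m2]_y (k%:E * f (x, y)) =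
   k%:E * \int[m1]_x \int[m2]_y f (x, y))%E.
Proof.
move=> mf f0 k0; rewrite -ge0_integralZl//; last 2 first.
  exact: (measurable_fun_fubini_tonelli_F f).
  by move=> x _; exact: integral_ge0.
apply: eq_integral => x _.
by rewrite (ge0_integralZl m2 measurableT (f := fun y => f (x, y)))//;
  exact: measurableT_comp.
Qed.

Section affine.
Variable R : realType.
Local Notation mu := (@lebesgue_measure R).

Let affine (a b : R) : measurableTypeR R -> measurableTypeR R :=
  fun x => a * x + b.

Let measurable_affine a b : measurable_fun setT (affine a b).
Proof. by apply: measurable_funD => //; exact: measurable_funM. Qed.

(** The pushforward of Lebesgue measure under [x |-> a x + b], multiplied by [|a|], gives every
    interval []x, y]] its length, so by uniqueness it is Lebesgue measure itself. *)
Lemma ge0_integral_affine (a b : R) (g : R -> \bar R) : a != 0 ->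
  measurable_fun setT g -> (forall x, 0 <= g x)%E ->
  (\int[mu]_x g (a * x + b)%R = (`|a|^-1)%:E * \int[mu]_x g x)%E.
Proof.
move=> a0 mg g0.
have na0 : 0 <= `|a| by [].
pose pm : {measure set (measurableTypeR R) -> \bar R} :=
  measure_function_pushforward__canonical__measure_function_Measure
    (@lebesgue_measure R) (measurable_affine a b).
pose nu := mscale (NngNum na0) pm.
have muE A : measurable A -> mu A = nu A.
  move=> mA; apply: (lebesgue_measure_unique (mu := nu)) => // _ [[x y]] /= xy <-.
  rewrite /nu /mscale/= /pushforward.
  have [a_gt0|] := ltP 0 a.
    have -> : affine a b @^-1` `]x, y] = `](x - b) / a, (y - b) / a]%classic.
      apply/seteqP; split => z /=; rewrite !in_itv/= /affine.
        by rewrite ltr_pdivrMr// ler_pdivlMr// ltrBlDr lerBrDr mulrC.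
      by rewrite ltr_pdivrMr// ler_pdivlMr// ltrBlDr lerBrDr mulrC.
    rewrite !lebesgue_measure_itv/= !lte_fin ltr_pM2r ?invr_gt0// ltrD2r.
    case: ifPn => _; last by rewrite mule0.
    rewrite -!EFinB -EFinM gtr0_norm//; congr EFin; field; exact: lt0r_neq0.
  rewrite le_eqVlt (negbTE a0)/= => a_lt0.
  (* A negative slope exchanges the endpoints and moves the open end to the right; the length is
     unaffected. *)
  have -> : affine a b @^-1` `]x, y] = `[(y - b) / a, (x - b) / a[%classic.
    apply/seteqP; split => z /=; rewrite !in_itv/= /affine.
      by rewrite ltr_ndivlMr// ler_ndivrMr// ltrBlDr lerBrDr mulrC andbC.
    by rewrite ltr_ndivlMr// ler_ndivrMr// ltrBlDr lerBrDr mulrC andbC.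
  rewrite !lebesgue_measure_itv/= !lte_fin ltr_nM2r ?invr_lt0// ltrD2r.
  case: ifPn => _; last by rewrite mule0.
  rewrite -!EFinB -EFinM ltr0_norm//; congr EFin; field; exact: ltr0_neq0.
have -> : (\int[mu]_x g x = \int[nu]_x g x)%E.
  by apply: eq_measure_integral => A mA _; exact: muE.
rewrite ge0_integral_mscale//= ge0_integral_pushforward//= preimage_setT.
rewrite muleA -EFinM mulVf ?mul1e// normr_eq0//.
Qed.

End affine.

Section plane.
Variable R : realType.
Local Notation T := (measurableTypeR R).
Local Notation mu := (@lebesgue_measure R).

(* For [a != 0] the similarity is the composite of the two maps
   [(x, y) |-> (a x - b y, y)] and
   [(u, y) |-> (u, b u / a + (a^2 + b^2) y / a)], each of which is affine in a single variable. *)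
Lemma ge0_integral_similarity (a b : R) (g : T * T -> \bar R) : a != 0 ->
  measurable_fun setT g -> (forall z, 0 <= g z)%E ->
  (\int[mu]_x \int[mu]_y g (a * x - b * y, a * y + b * x)%R =
   ((a ^+ 2 + b ^+ 2)^-1)%:E * \int[mu]_x \int[mu]_y g (x, y))%E.
Proof.
move=> a0 mg g0.
pose c := (a ^+ 2 + b ^+ 2) / a.
have ab0 : a ^+ 2 + b ^+ 2 != 0.
  by rewrite gt_eqF// ltr_pwDl ?sqr_ge0// exprn_even_gt0.
have c0 : c != 0 by rewrite mulf_neq0// invr_neq0.
pose h (u : T * T) := g (u.1, b / a * u.1 + c * u.2)%R.
have h0 z : (0 <= h z)%E by exact: g0.
have mh : measurable_fun setT h.
  apply: measurableT_comp => //; apply: measurable_fun_pair => //.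
  by apply: measurable_funD; apply: measurable_funM.
have mswap : measurable_fun setT (fun z : T * T => h (a * z.1 + - b * z.2, z.2)).
  apply: measurableT_comp => //; apply: measurable_fun_pair => //.
  by apply: measurable_funD; apply: measurable_funM.
transitivity (\int[mu]_x \int[mu]_y h (a * x + - b * y, y)%R)%E.
  apply: eq_integral => x _; apply: eq_integral => y _.
  rewrite /h /c/=; congr (g (_, _)); first by rewrite mulNr.
  by field.
(* With [x] innermost, the first map is affine in [x] for fixed [y] and contributes [|a|^-1]. The
   order is then restored so that the second map, affine in [y] with slope [c], contributes
   [|c|^-1]; and [|a| |c| = a^2 + b^2]. *)
rewrite (fubini_tonelli (fun z : T * T => h (a * z.1 + - b * z.2, z.2)))//=.
transitivity (\int[mu]_y (`|a|^-1%:E * \int[mu]_x h (x, y)))%E.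
  apply: eq_integral => y _; rewrite -(ge0_integral_affine (- b * y) a0)//.
  exact: measurableT_comp.
rewrite (ge0_integralZl mu measurableT (f := fun y => \int[mu]_x h (x, y))%E)
  ?lee_fin ?invr_ge0//; last 2 first.
  exact: (measurable_fun_fubini_tonelli_G h).
  by move=> y _; exact: integral_ge0.
rewrite -(fubini_tonelli h mh h0).
transitivity (`|a|^-1%:E * \int[mu]_x (`|c|^-1%:E * \int[mu]_y g (x, y)))%E.
  congr *%E; apply: eq_integral => x _.
  rewrite -(ge0_integral_affine (b / a * x) c0)//; last exact: measurableT_comp.
  by apply: eq_integral => y _; rewrite /h/= [in RHS]addrC.
rewrite (ge0_integralZl mu measurableT (f := fun x => \int[mu]_y g (x, y))%E)
  ?lee_fin ?invr_ge0//; last 2 first.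
  exact: (measurable_fun_fubini_tonelli_F g).
  by move=> y _; exact: integral_ge0.
rewrite muleA -EFinM -invfM -normrM /c mulrCA divff// mulr1 ger0_norm//.
by rewrite addr_ge0 ?sqr_ge0.
Qed.

End plane.

(** * Slicing and dilation of Lebesgue measure on real and complex tuples *)

Section tuples.
Variable R : realType.
Local Notation T := (measurableTypeR R).
Local Notation mu := (@lebesgue_measure R).
Local Notation C := R[i].

Lemma measurable_cons_section n (A : set (n.+1.-tuple T)) (x : T) :
  measurable A -> measurable [set t : n.-tuple T | A [tuple of x :: t]].
Proof.
move=> mA.
have mc : measurable_fun setT (fun t : n.-tuple T => [tuple of x :: t]).
  by apply: measurable_cons => //; exact: measurable_id.
by rewrite -[X in measurable X]setTI; exact: mc.
Qed.

Lemma lebesgue_tupleS n (A : set (n.+1.-tuple T)) :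
  lebesgue_tuple R n.+1 A =
  (\int[mu]_x lebesgue_tuple R n [set t : n.-tuple T | A [tuple of x :: t]])%E.
Proof.
rewrite /= /cons_measure /pushforward /product_measure1.
apply: eq_integral => x _ /=; congr (lebesgue_tuple R n _).
by apply/seteqP; split => t; rewrite /xsection/= inE.
Qed.

Lemma measurable_fun_lebesgue_tuple d (X : measurableType d) n
    (A : set (X * n.-tuple T)) : measurable A ->
  measurable_fun setT (fun x => lebesgue_tuple R n [set t | A (x, t)]).
Proof.
move=> mA; rewrite (_ : (fun x => _) = lebesgue_tuple R n \o xsection A).
  exact: measurable_fun_xsection.
apply/funext => x /=; congr (lebesgue_tuple R n _).
by apply/seteqP; split => t; rewrite /xsection/= inE.
Qed.

(** Induction on [n]: the slice at [x] of the rescaled set is the rescaled slice of [A] at [c x].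
    The induction hypothesis treats the tail, an affine substitution the head, and each coordinate
    yields one factor [|c|^-1]. *)
Lemma lebesgue_tuple_scale n (c : R) (A : set (n.-tuple T)) : c != 0 ->
  measurable A ->
  (lebesgue_tuple R n [set t : n.-tuple T | A [tuple of map ( *%R c) t]] =
   (`|c| ^- n)%:E * lebesgue_tuple R n A)%E.
Proof.
move=> c0; elim: n A => [|n IHn] A mA.
  rewrite expr0 invr1 mul1e; congr (lebesgue_tuple R 0 _).
  by apply/funext => t /=; congr (A _); apply/val_inj; rewrite (tuple0 t).
rewrite !lebesgue_tupleS.
pose g x := lebesgue_tuple R n [set t : n.-tuple T | A [tuple of x :: t]].
have mg : measurable_fun setT g.
  apply: (measurable_fun_lebesgue_tuple (A := [set p | A (cons_pair p)])).
  by rewrite -[X in measurable X]setTI; exact: measurable_cons_pair.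
transitivity (\int[mu]_x ((`|c| ^- n)%:E * g (c * x + 0)%R))%E.
  apply: eq_integral => x _; rewrite -IHn ?addr0; last exact: measurable_cons_section.
  congr (lebesgue_tuple R n _).
  by apply/funext => t /=; congr (A _); apply/val_inj.
rewrite ge0_integralZl//=; last first.
  by apply: measurableT_comp => //; apply: measurable_funD => //; exact: measurable_funM.
by rewrite ge0_integral_affine// muleA -EFinM -invfM (exprSr _ n).
Qed.

Lemma complexvec_cons n (x y : R) (t : n.*2.-tuple R) :
  complexvec (n := n.+1) [tuple of x :: y :: t] =
  [tuple of (x +i* y)%C :: complexvec t].
Proof.
apply: eq_from_tnth => i; rewrite tnth_mktuple.
case: (unliftP ord0 i) => [j ->|->]; last by rewrite tnth0.
by rewrite tnthS tnth_mktuple.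
Qed.

Lemma lebesgue_ctupleS n (A : set (n.+1.-tuple C)) :
  lebesgue_ctuple A =
  (\int[mu]_x \int[mu]_y
     lebesgue_ctuple [set t : n.-tuple C | A [tuple of (x +i* y)%C :: t]])%E.
Proof.
rewrite /lebesgue_ctuple lebesgue_tupleS; apply: eq_integral => x _.
rewrite (@lebesgue_tupleS n.*2); apply: eq_integral => y _.
congr (lebesgue_tuple R n.*2 _).
by apply/funext => t /=; rewrite -complexvec_cons.
Qed.

(** Borel measurability on [C^n], transported from [R^(2n)] along [complexvec] just as
    [lebesgue_ctuple] is. *)
Definition cmeasurable n (A : set (n.-tuple C)) :=
  measurable (@complexvec R n @^-1` A : set (n.*2.-tuple T)).

Lemma cmeasurable_cons_section n (A : set (n.+1.-tuple C)) z :
  cmeasurable A -> cmeasurable [set t : n.-tuple C | A [tuple of z :: t]].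
Proof.
case: z => x y mA; rewrite /cmeasurable.
have := measurable_cons_section y (measurable_cons_section x mA).
by congr measurable; apply/funext => t /=; rewrite -complexvec_cons.
Qed.

Lemma measurable_fun_lebesgue_ctuple n (A : set (n.+1.-tuple C)) :
  cmeasurable A ->
  measurable_fun setT (fun z : T * T =>
    lebesgue_ctuple [set t : n.-tuple C | A [tuple of (z.1 +i* z.2)%C :: t]]).
Proof.
move=> mA.
pose f (p : (T * T) * n.*2.-tuple T) : n.*2.+2.-tuple T :=
  [tuple of p.1.1 :: [tuple of p.1.2 :: p.2]].
have mf : measurable_fun setT f.
  apply: measurable_cons; first exact: measurableT_comp.
  by apply: measurable_cons => //; exact: measurableT_comp.
have := @measurable_fun_lebesgue_tuple _ _ _
  (f @^-1` (@complexvec R n.+1 @^-1` A)).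
rewrite -[X in measurable X]setTI => /(_ (mf measurableT _ mA)).
congr measurable_fun; apply/funext => z; congr (lebesgue_tuple R n.*2 _).
by apply/funext => t /=; rewrite -complexvec_cons.
Qed.

(** Multiplication by [a + ib] acts on each complex coordinate as a plane similarity of Jacobian
    [a^2 + b^2]. The condition [a != 0] is the one under which that similarity factors into
    one-variable affine maps; in the application it leaves out only a null set of leading
    coefficients. *)
Lemma lebesgue_ctuple_scale n (a b : R) (A : set (n.-tuple C)) : a != 0 ->
  cmeasurable A ->
  (lebesgue_ctuple [set t : n.-tuple C | A [tuple of map ( *%R (a +i* b)%C) t]] =
   ((a ^+ 2 + b ^+ 2) ^- n)%:E * lebesgue_ctuple A)%E.
Proof.
move=> a0; elim: n A => [|n IHn] A mA.
  rewrite expr0 invr1 mul1e; congr lebesgue_ctuple.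
  by apply/funext => t /=; congr (A _); apply/val_inj; rewrite (tuple0 t).
rewrite !lebesgue_ctupleS.
pose g (z : T * T) :=
  lebesgue_ctuple [set t : n.-tuple C | A [tuple of (z.1 +i* z.2)%C :: t]].
have mg : measurable_fun setT g by exact: measurable_fun_lebesgue_ctuple.
have g0 z : (0 <= g z)%E by exact: measure_ge0.
have ab0 : 0 <= (a ^+ 2 + b ^+ 2) ^- n.
  by rewrite invr_ge0 exprn_ge0// addr_ge0 ?sqr_ge0.
(* [h] is [g] after multiplication by [a + ib], written in real coordinates. *)
pose h (z : T * T) := g (a * z.1 - b * z.2, a * z.2 + b * z.1).
have mh : measurable_fun setT h.
  apply: measurableT_comp => //; apply: measurable_fun_pair => //.
    by apply: measurable_funB; apply: measurable_funM.
  by apply: measurable_funD; apply: measurable_funM.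
have h0 z : (0 <= h z)%E by exact: g0.
transitivity (\int[mu]_x \int[mu]_y (((a ^+ 2 + b ^+ 2) ^- n)%:E * h (x, y)))%E.
  apply: eq_integral => x _; apply: eq_integral => y _.
  rewrite -IHn; last exact: cmeasurable_cons_section.
  congr lebesgue_ctuple.
  by apply/funext => t /=; congr (A _); apply/val_inj.
rewrite (ge0_iterated_integralZl mu mu mh h0 ab0).
by rewrite (ge0_integral_similarity b a0 mg g0) muleA -EFinM -invfM (exprSr _ n).
Qed.

End tuples.

(** * One-dimensional integrals and the area of the disk *)

Section integrals.
Variable R : realType.
Local Notation mu := (@lebesgue_measure R).

Lemma integral_deriv (p : {poly R}) (a b : R) : a <= b ->
  (\int[mu]_(x in `[a, b]) (p^`().[x])%:E = (p.[b] - p.[a])%:E)%E.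
Proof.
rewrite le_eqVlt => /predU1P[->|ab]; first by rewrite set_itv1 integral_set1 subrr.
rewrite (continuous_FTC2 ab (F := horner p)) ?EFinB//.
- by apply: continuous_subspaceT; exact: continuous_horner.
- split.
  + by move=> x _; exact: derivable_horner.
  + by apply: cvg_at_right_filter; exact: continuous_horner.
  + by apply: cvg_at_left_filter; exact: continuous_horner.
- by move=> x _; rewrite derivE.
Qed.

(** The antiderivative [- x^(-s) / s] tends to 0 at infinity because [s > 0]. *)
Lemma integral_powRNn (s : nat) (a : R) : 0 < a -> (0 < s)%N ->
  (\int[mu]_(x in `[a, +oo[) (x `^ (- s%:R) * x^-1)%:E =
   (a `^ (- s%:R) / s%:R)%:E)%E.
Proof.
move=> a0 s0.
have sn0 : s%:R != 0 :> R by rewrite pnatr_eq0 -lt0n.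
pose F (x : R) := - s%:R^-1 * x `^ (- s%:R).
have dF (x : R) : 0 < x -> is_derive x 1 F (x `^ (- s%:R) * x^-1).
  move=> x0; have dx := is_derive1_powR (- s%:R) x0.
  have -> : F = (- s%:R^-1) *: (@powR R ^~ (- s%:R) : R -> R^o) by [].
  apply: is_derive_eq; rewrite /GRing.scale/= mulrA mulrNN mulVf// mul1r.
  by rewrite powRB ?lt0r_neq0 ?implybT// powRr1 ?ltW.
have cP (x : R) : 0 < x -> {for x, continuous (@powR R ^~ (- s%:R))}.
  move=> x0; apply: differentiable_continuous; apply/derivable1_diffP.
  by have [] := is_derive1_powR (- s%:R) x0.
have cF (x : R) : 0 < x -> {for x, continuous F}.
  by move=> x0; apply: cvgM; [exact: cvg_cst|exact: cP].
have Fy : F x @[x --> +oo] --> (0 : R).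
  rewrite -(mulr0 (- s%:R^-1)); apply: cvgM; first exact: cvg_cst.
  have V0 : (fun x : R => x^-1) x @[x --> +oo] --> (0 : R).
    by apply/(gtr0_cvgV0 (f := id)) => //; exact: nbhs_pinfty_gt.
  have := cvg_comp _ _ V0 (@exprn_continuous R s 0).
  rewrite /= expr0n eqn0Ngt s0/=; apply: cvg_trans; apply: near_eq_cvg.
  near=> x; have x0 : 0 <= x by near: x; exact: nbhs_pinfty_ge.
  by rewrite /= exprVn powRN powR_mulrn.
rewrite (@ge0_continuous_FTC2y _ _ F _ 0)//.
- by rewrite sub0e /F mulNr EFinN oppeK mulrC.
- by move=> x ax; rewrite mulr_ge0 ?powR_ge0// invr_ge0 (le_trans (ltW a0)).
- apply: continuous_in_subspaceT => x; rewrite inE/= in_itv/= andbT => ax.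
  have x0 := lt_le_trans a0 ax.
  apply: (cvgM (cP _ x0)).
  by apply: inv_continuous; exact: lt0r_neq0.
- by move=> x ax; have [] := dF _ (lt_trans a0 ax).
- by apply: cvg_at_right_filter; exact: cF.
- move=> x; rewrite in_itv/= andbT => ax; rewrite derive1E.
  exact: (derive_val (is_derive := dF _ (lt_trans a0 ax))).
Unshelve. all: by end_near. Qed.

End integrals.

Section disk.
Variable R : realType.
Local Notation T := (measurableTypeR R).
Local Notation mu := (@lebesgue_measure R).

Definition plane_norm (z : T * T) : R := Num.sqrt (z.1 ^+ 2 + z.2 ^+ 2).

Lemma measurable_plane_norm : measurable_fun setT plane_norm.
Proof.
apply: (measurableT_comp (f := @Num.sqrt R)).
  by apply: continuous_measurable_fun; exact: sqrt_continuous.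
by apply: measurable_funD; apply: measurable_funX.
Qed.

(** The integrand is the length of the vertical chord of the disk at abscissa [x]. The substitution
    [x = r sin t], with [t] between [- pi / 2] and [pi / 2], turns the integral into that of
    [2 r^2 cos^2 t]. *)
Lemma integral_half_disk (r : R) : 0 < r ->
  (\int[mu]_(x in `[(- r)%R, r]) (2 * Num.sqrt (r ^+ 2 - x ^+ 2))%R%:E =
   (pi * r ^+ 2)%:E)%E.
Proof.
move=> r0.
pose F (t : R) := r * sin t; pose h : R := pi / 2.
have h0 : 0 < h by rewrite divr_gt0// pi_gt0.
have hh : - h < h by rewrite gtrN.
have dF (t : R) : is_derive t 1 F (r * cos t).
  have -> : F = r *: (@sin R : R -> R^o) by [].
  exact: is_derive_eq.
have F'E : derive1 F = fun t => r * cos t.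
  by apply/funext => t; rewrite derive1E; exact: derive_val.
have cF' : continuous (derive1 F).
  by rewrite F'E => t; apply: cvgM; [exact: cvg_cst|exact: continuous_cos].
have cF : continuous F.
  by move=> t; apply: cvgM; [exact: cvg_cst|exact: continuous_sin].
have Fh : F h = r by rewrite /F /h sin_pihalf mulr1.
have FNh : F (- h) = - r by rewrite /F sinN mulrN -/(F h) Fh.
rewrite -[in `[_, _]]FNh -[in `[_, _]]Fh
  integration_by_substitution_increasing//; last 5 first.
- move=> s t sh th st; rewrite /F ltr_pM2l// ltr_sin//.
- by apply: cvgP; exact/cvg_at_right_filter/cF'.
- by apply: cvgP; exact/cvg_at_left_filter/cF'.
- split.
  + by move=> t _; have [] := dF t.
  + exact/cvg_at_right_filter/cF.
  + exact/cvg_at_left_filter/cF.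
- apply: continuous_subspaceT => x; apply: cvgM; first exact: cvg_cst.
  apply: (cvg_comp (fun y : R => r ^+ 2 - y ^+ 2) (@Num.sqrt R)); last exact: sqrt_continuous.
  apply: cvgB; first exact: cvg_cst.
  exact: exprn_continuous.
pose P (t : R) := r ^+ 2 * (t + sin t * cos t).
pose f (t : R) := r ^+ 2 * (2 * cos t ^+ 2).
transitivity (\int[mu]_(t in `[(- h)%R, h]) (f t)%:E)%E.
  apply: eq_integral => t /set_mem/=; rewrite in_itv/= => th.
  congr EFin; rewrite -[LHS]/(2 * Num.sqrt (r ^+ 2 - F t ^+ 2) * derive1 F t) F'E /F.
  have -> : r ^+ 2 - (r * sin t) ^+ 2 = (r * cos t) ^+ 2.
    by rewrite !exprMn cos2sin2; ring.
  (* The absolute value disappears because [cos] is nonnegative between [- pi / 2] and [pi / 2]. *)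
  rewrite sqrtr_sqr ger0_norm; first by rewrite /f; ring.
  by rewrite mulr_ge0//; [exact: ltW|exact: cos_ge0_pihalf].
have dP (t : R) : is_derive t 1 P (f t).
  have -> : P = r ^+ 2 *: (id + (@sin R : R -> R^o) * (@cos R : R -> R^o)) by [].
  apply: is_derive_eq; rewrite /GRing.scale/= /f; congr (_ * _).
  by rewrite -{1}(cos2Dsin2 t); ring.
have cP : continuous P.
  by move=> t; apply: differentiable_continuous;
    apply/derivable1_diffP; have [] := dP t.
rewrite (continuous_FTC2 hh (F := P)) -?EFinB.
- congr EFin; rewrite /P sinN cosN /h sin_pihalf cos_pihalf; by field.
- apply: continuous_subspaceT => t; apply: cvgM; first exact: cvg_cst.
  apply: cvgM; first exact: cvg_cst.
  apply: (cvg_comp (@cos R) (fun x : R => x ^+ 2)); first exact: continuous_cos.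
  exact: exprn_continuous.
- split.
  + by move=> t _; have [] := dP t.
  + exact/cvg_at_right_filter/cP.
  + exact/cvg_at_left_filter/cP.
- by move=> t _; rewrite derive1E; exact: derive_val.
- exact: ltW.
Qed.

Lemma plane_norm_le (z : T * T) (r : R) : 0 <= r ->
  (plane_norm z <= r) = (z.1 ^+ 2 + z.2 ^+ 2 <= r ^+ 2).
Proof.
move=> r0; rewrite -[LHS]ler_sqr ?nnegrE ?sqrtr_ge0// sqr_sqrtr//.
by rewrite addr_ge0 ?sqr_ge0.
Qed.

(** Slice by vertical lines: the section at [x] is the chord [[-q, q]] with [q = sqrt (r^2 - x^2)]
    when [|x| <= r], and empty otherwise. *)
Lemma plane_ball (r : R) : 0 <= r ->
  (mu \x mu)%E [set z | (plane_norm z <= r)%R] = (pi * r ^+ 2)%:E.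
Proof.
move=> r0; rewrite /product_measure1/=.
transitivity (\int[mu]_(x in `[(- r)%R, r]) (2 * Num.sqrt (r ^+ 2 - x ^+ 2))%R%:E)%E.
  rewrite [RHS]integral_mkcond; apply: eq_integral => x _; rewrite patchE.
  have -> : xsection [set z | plane_norm z <= r] x =
      [set y | x ^+ 2 + y ^+ 2 <= r ^+ 2].
    by apply/seteqP; split => y; rewrite /xsection/= in_setE/= plane_norm_le.
  have xE : (x \in `[- r, r]) = (x ^+ 2 <= r ^+ 2).
    by rewrite in_itv/= -ler_norml -ler_sqr ?nnegrE// real_normK ?num_real.
  case: ifPn => [/set_mem/=|/negP xN].
    rewrite xE => xr; pose q := Num.sqrt (r ^+ 2 - x ^+ 2).
    have -> : [set y | x ^+ 2 + y ^+ 2 <= r ^+ 2] = `[- q, q]%classic.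
      have qE y : (y \in `[- q, q]) = (x ^+ 2 + y ^+ 2 <= r ^+ 2).
        rewrite in_itv/= -ler_norml -[LHS]ler_sqr ?nnegrE ?sqrtr_ge0//.
        by rewrite sqr_sqrtr ?subr_ge0// real_normK ?num_real// lerBrDl.
      by apply/seteqP; split => y; rewrite /= qE.
    rewrite lebesgue_measure_itv/= lte_fin; case: ifPn => [_|].
      by rewrite -EFinB opprK -mulr2n mulr_natl.
    (* The degenerate chord: [q = 0], and both sides vanish. *)
    rewrite -leNgt => q0; have q_ge0 : 0 <= q by exact: sqrtr_ge0.
    by rewrite -/q (_ : q = 0) ?mulr0//; lra.
  rewrite (_ : mkset _ = set0) ?measure0//; apply/seteqP; split => // y /= xyr.
  apply: xN; apply/mem_set; rewrite /= xE (le_trans _ xyr)// lerDl sqr_ge0//.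
move: r0; rewrite le_eqVlt => /predU1P[<-|r0]; last exact: integral_half_disk.
by rewrite oppr0 set_itv1 integral_set1 expr0n mulr0.
Qed.

(* The canonical sigma-finite structure on [\x] expects subprobability factors,
   whence a separate name for the planar Lebesgue measure. *)
Definition plane_measure : set (T * T) -> \bar R := (mu \x mu)%E.

HB.instance Definition _ := Measure.on plane_measure.

Let plane_measure_sigma_finite : sigma_finite setT plane_measure.
Proof.
exists (fun k => [set z | plane_norm z <= k%:R]).
  apply/seteqP; split => // z _; exists (Num.bound (plane_norm z)) => //.
  exact/ltW/archi_boundP/sqrtr_ge0.
move=> k; split; last by rewrite [X in (X < _)%E]plane_ball ?ltry.
apply: measurable_set_bool; apply: measurable_fun_ler => //.
exact: measurable_plane_norm.
Qed.

HB.instance Definition _ := Measure_isSigmaFinite.Build _ _ _ plane_measure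
  plane_measure_sigma_finite.

End disk.

(** * Radial integrals and Mellin transforms *)

Section weighted_tonelli.
Local Open Scope ereal_scope.
Context d1 d2 (X : measurableType d1) (Y : measurableType d2) (R : realType).
Variables (m1 : {sigma_finite_measure set X -> \bar R})
  (m2 : {sigma_finite_measure set Y -> \bar R}).

Variables (S : set (X * Y)) (g : X -> R).
Hypotheses (mS : measurable S) (mg : measurable_fun setT g)
  (g0 : forall z, S z -> (0 <= g z.1)%R).

Let f (z : X * Y) := (g z.1 * \1_S z)%:E.

Let mf : measurable_fun setT f.
Proof.
apply/measurable_EFinP; apply: measurable_funM => //.
exact: measurableT_comp.
Qed.

Let f0 z : 0 <= f z.
Proof.
rewrite lee_fin indicE; have [zS|] := boolP (z \in S); last by rewrite mulr0.
by rewrite mulr1 g0//; exact: set_mem.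
Qed.

Let section_integralE y :
  \int[m1]_(x in [set x | S (x, y)]) (g x)%:E = \int[m1]_x f (x, y).
Proof.
rewrite integral_mkcond; apply: eq_integral => x _.
rewrite /f patchE indicE /=.
have -> : (x \in [set x | S (x, y)]) = ((x, y) \in S).
  by apply/idP/idP => /set_mem h; exact/mem_set.
by case: ifP; rewrite ?mulr1 ?mulr0.
Qed.

Lemma measurable_section_integral :
  measurable_fun setT (fun y => \int[m1]_(x in [set x | S (x, y)]) (g x)%:E).
Proof.
rewrite (eq_fun section_integralE); exact: measurable_fun_fubini_tonelli_G.
Qed.

Lemma weighted_tonelli :
  \int[m1]_x ((g x)%:E * m2 [set y | S (x, y)]) =
  \int[m2]_y \int[m1]_(x in [set x | S (x, y)]) (g x)%:E.
Proof.
under [RHS]eq_integral do rewrite section_integralE.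
rewrite -(fubini_tonelli f)//; apply: eq_integral => x _.
have mSx : measurable [set y | S (x, y)].
  have := measurable_xsection x mS; rewrite /xsection.
  by under eq_set do rewrite in_setE.
have -> : (fun y => f (x, y)) =
    (fun y => (g x * \1_((fun=> [set y | S (x, y)]) (g x)) y)%:E).
  apply/funext => y; rewrite /f !indicE/=.
  have -> // : (y \in [set y | S (x, y)]) = ((x, y) \in S).
  by apply/idP/idP => /set_mem h; exact/mem_set.
rewrite (integralZl_indic _ (fun=> [set y | S (x, y)]))//.
  by rewrite integral_indic//= setIT.
(* Where [g x < 0], the slice of [S] is empty and there is nothing to integrate. *)
by move=> gx0; apply/seteqP; split => // y /g0/=; rewrite leNgt gx0.
Qed.

End weighted_tonelli.

Section radial.
Context dW dB (W : measurableType dW) (B : measurableType dB) (R : realType).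
Variables (m : {sigma_finite_measure set W -> \bar R})
  (nu : {sigma_finite_measure set B -> \bar R}).
Variables (nrm : W -> R) (phi : B -> R) (K : R) (d : nat).
Hypotheses (mnrm : measurable_fun setT nrm) (mphi : measurable_fun setT phi)
  (nrm_ge0 : forall w, 0 <= nrm w) (phi_gt0 : forall b, 0 < phi b)
  (K_ge0 : 0 <= K)
  (m_ball : forall r, 0 <= r -> m [set w | nrm w <= r] = (K * r ^+ d)%:E).

(* Layer cake: [nrm w ^+ k] is the integral of [k * r ^+ k.-1] over [0, nrm w[. *)
Lemma integral_ball_exprn (k : nat) (rho : R) : (0 < k)%N -> 0 <= rho ->
  (\int[m]_(w in [set w | (nrm w <= rho)%R]) (nrm w ^+ k)%R%:E =
   (K * d%:R / (k + d)%:R * rho ^+ (k + d))%R%:E)%E.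
Proof.
move=> k0 rho0.
pose S : set (measurableTypeR R * W) :=
  [set z | (0 <= z.1) && (z.1 < nrm z.2) && (nrm z.2 <= rho)].
pose g (r : R) : R := k%:R * r ^+ k.-1.
have mg : measurable_fun setT g by apply: measurable_funM.
have mS : measurable S.
  apply: measurable_set_bool; apply: measurable_and; last first.
    by apply: measurable_fun_ler => //; exact: measurableT_comp.
  apply: measurable_and; first exact: measurable_fun_ler.
  by apply: measurable_fun_ltr => //; exact: measurableT_comp.
have mball r : measurable [set w | nrm w <= r].
  by apply: measurable_set_bool; exact: measurable_fun_ler.
transitivity (\int[m]_w \int[lebesgue_measure]_(r in [set r | S (r, w)]) (g r)%:E)%E.
  rewrite integral_mkcond; apply: eq_integral => w _; rewrite patchE.
  case: ifPn => [/set_mem/= wrho|/negP wrho]; last first.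
    rewrite [X in (\int[_]_(_ in X) _)%E](_ : _ = set0) ?integral_set0//.
    by apply/seteqP; split => // r /= /andP[_ rw]; apply: wrho; exact/mem_set.
  have -> : [set r | S (r, w)] = `[0, nrm w[%classic.
    by apply/seteqP; split => r; rewrite /S/= in_itv/= wrho andbT.
  (* Adding the endpoint [nrm w] does not change the integral, and closes the interval for the
     fundamental theorem of calculus. *)
  rewrite integral_itv_bndo_bndc; last first.
    by apply: measurable_funTS; exact/measurable_EFinP.
  under eq_integral => r _.
    rewrite (_ : g r = ('X^k)^`().[r]); last first.
      by rewrite /g derivXn hornerMn hornerXn mulr_natl.
    over.
  by rewrite integral_deriv// !hornerXn expr0n eqn0Ngt k0 subr0.
rewrite -weighted_tonelli//; last first.
  by move=> [r w] /= /andP[/andP[r0 _] _]; rewrite /g mulr_ge0// exprn_ge0.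
have kd0 : (k + d)%:R != 0 :> R by rewrite pnatr_eq0 addn_eq0 !eqn0Ngt k0.
pose c : R := k%:R / (k + d)%:R.
(* For [r] in [[0, rho]] the slice is the shell [r < nrm w <= rho], of measure [K (rho^d - r^d)].
   [p] is the antiderivative of [k r^(k-1)] times this measure; it vanishes at 0, and
   [1 - c = d / (k + d)] gives the constant at [rho]. *)
pose p : {poly R} := K *: (rho ^+ d *: 'X^k - c *: 'X^(k + d)).
transitivity (\int[lebesgue_measure]_(r in `[0%R, rho]) (p^`().[r])%:E)%E.
  rewrite [RHS]integral_mkcond; apply: eq_integral => r _; rewrite patchE.
  case: ifPn => [/set_mem/=|/negP rN].
    rewrite in_itv/= => /andP[r0 rrho].
    have -> : [set w | S (r, w)] = [set w | nrm w <= rho] `\` [set w | nrm w <= r].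
      apply/seteqP; split => w; rewrite /S/= r0/= ltNge.
        by move=> /andP[/negP].
      by move=> [-> /negP ->].
    have -> : m ([set w | nrm w <= rho] `\` [set w | nrm w <= r]) =
        (K * rho ^+ d - K * r ^+ d)%:E.
      rewrite measureD//; last by rewrite [X in (X < _)%E](m_ball rho0) ltry.
      rewrite setIidr; last by move=> w /= /le_trans; exact.
      by rewrite EFinB; congr (_ - _)%E; exact: m_ball.
    rewrite -EFinM; congr EFin.
    rewrite /p derivZ derivB !derivZ !derivXn !(hornerE, hornerMn)/=.
    rewrite -[_ *+ k]mulr_natl -[_ *+ (k + d)]mulr_natl /g /c.
    rewrite -[in (k + d).-1](prednK k0) addSn/= exprD.
    by field; rewrite -natrD.
  rewrite (_ : [set y | S (r, y)] = set0) ?measure0 ?mule0//.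
  apply/seteqP; split => // w; rewrite /S/= => /andP[/andP[r0 rw] wrho].
  by apply: rN; apply/mem_set; rewrite /= in_itv/= r0 (ltW (lt_le_trans rw wrho)).
rewrite integral_deriv//; congr EFin.
rewrite /p !hornerE/= !expr0n addn_eq0 !eqn0Ngt k0/= /c exprD.
by field; rewrite -natrD.
Qed.

(** Tonelli makes both sides integrals over [b]. On the left the inner integral is that of [nrm^k]
    over the ball of radius [1 / phi b]; on the right it is that of [xi^(-s-1)] over [[phi b, +oo[].
    Both are multiples of [(phi b)^(-s)], with constants [K d / s] and [1 / s]. An abstract [nrm]
    serves the line and the plane at once. *)
Theorem radial_mellin (k : nat) : (0 < k)%N ->
  (\int[m]_w ((nrm w ^+ k)%R%:E * nu [set b | (nrm w * phi b <= 1)%R]) =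
   (K * d%:R)%R%:E *
     mellin (fun xi => nu [set b | (phi b <= xi)%R]) (k + d)%:R)%E.
Proof.
move=> k0.
pose s := (k + d)%N.
have s0 : (0 < s)%N by rewrite addn_gt0 k0.
rewrite (@weighted_tonelli _ _ _ _ _ _ _
  [set z | nrm z.1 * phi z.2 <= 1] (fun w => nrm w ^+ k)); last 3 first.
- apply: measurable_set_bool; apply: measurable_fun_ler => //.
  by apply: measurable_funM; exact: measurableT_comp.
- exact: measurable_funX.
- by move=> [w b] _; exact: exprn_ge0.
pose S : set (measurableTypeR R * B) := [set z | phi z.2 <= z.1].
(* The real power replaces [xi^-1] so that [g] is nonnegative on the whole line; the two agree for
   [xi > 0]. *)
pose g (xi : R) : R := xi `^ (- s%:R) * xi `^ (-1).
have g0 xi : 0 <= g xi by rewrite mulr_ge0 ?powR_ge0.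
have gE xi : 0 < xi -> g xi = xi `^ (- s%:R) * xi^-1.
  by move=> xi0; rewrite /g powR_inv1// ltW.
have -> : mellin (fun xi => nu [set b | (phi b <= xi)%R]) s%:R =
    (\int[lebesgue_measure]_xi ((g xi)%:E * nu [set b | S (xi, b)]))%E.
  rewrite /mellin integral_mkcond; apply: eq_integral => xi _; rewrite patchE.
  case: ifPn => [/set_mem/=|/negP xiN].
    rewrite in_itv/= andbT => xi0.
    by rewrite gE// muleAC -EFinM.
  (* Since [phi > 0], no [b] satisfies [phi b <= xi] when [xi <= 0], so the Mellin integral may run
     over the whole line. *)
  rewrite (_ : [set b | (phi b <= xi)%R] = set0) ?measure0 ?mule0//.
  apply/seteqP; split => // b; rewrite /S/= => bxi.
  by apply: xiN; apply/mem_set; rewrite /= in_itv/= (lt_le_trans (phi_gt0 b) bxi).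
have mS : measurable S.
  apply: measurable_set_bool; apply: measurable_fun_ler => //.
  exact: measurableT_comp.
have mg : measurable_fun setT g.
  by apply: measurable_funM; exact: measurable_powR.
rewrite weighted_tonelli//.
rewrite -ge0_integralZl//; last 3 first.
- by apply: measurable_section_integral.
- by move=> b _; apply: integral_ge0 => xi _; rewrite lee_fin.
- by rewrite lee_fin mulr_ge0.
apply: eq_integral => b _; have b0 := phi_gt0 b.
have -> : [set xi | S (xi, b)] = `[phi b, +oo[%classic.
  by apply/seteqP; split => xi; rewrite /S/= in_itv/= andbT.
rewrite (eq_integral (fun xi : measurableTypeR R => (xi `^ (- s%:R) * xi^-1)%:E)); last first.
  move=> xi /set_mem/=; rewrite in_itv/= andbT => bxi.
  by rewrite gE// (lt_le_trans b0).
rewrite integral_powRNn//.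
have -> : [set w | [set z | nrm z.1 * phi z.2 <= 1] (w, b)] =
    [set w | nrm w <= (phi b)^-1].
  by apply/seteqP; split => w /=; rewrite -ler_pdivlMr// div1r.
rewrite integral_ball_exprn ?invr_ge0 ?ltW// -EFinM; congr EFin.
by rewrite powRN powR_mulrn ?ltW// exprVn -/s; ring.
Qed.

End radial.

(** * Measurability of multiplicative distances *)

(** Whatever [g] is, a preimage under [g \o q] is a countable union of fibres of [q]. *)
Lemma measurable_countable_comp d d' (X : measurableType d) (K : countType)
    (Y : measurableType d') (q : X -> K) (g : K -> Y) :
  (forall z, measurable (q @^-1` [set z])) -> measurable_fun setT (g \o q).
Proof.
move=> mq _ A mA; rewrite setTI.
rewrite (_ : _ @^-1` A = \bigcup_(z in g @^-1` A) (q @^-1` [set z])); last first.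
  apply/seteqP; split => [x /= Agqx|x [z /= Agz qxz]]; first by exists (q x).
  by rewrite /= qxz.
rewrite bigcup_mkcond; apply: countable_bigcupT_measurable => // z.
by case: ifPn.
Qed.

Section discretization.
Variable R : realType.
Local Notation T := (measurableTypeR R).

(** Index of the cell of mesh [1 / (k + 1)] containing [x]; the shift by one keeps the mesh defined
    at [k = 0]. *)
Let grid (k : nat) (x : R) : int := Num.floor (k.+1%:R * x).

Let grid_cvg (x : R) : ((grid k x)%:~R / k.+1%:R : R) @[k --> \oo] --> x.
Proof.
apply/cvgrPdist_le => e e0; near=> k.
have k0 : 0 < k.+1%:R :> R by [].
have /andP[gx xg] := real_floor_itv (num_real (k.+1%:R * x)).
have ek : k.+1%:R^-1 <= e.
  by apply/ltW; near: k; exact: (near_infty_natSinv_lt (PosNum e0)).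
have -> : x - (grid k x)%:~R / k.+1%:R =
    (k.+1%:R * x - (grid k x)%:~R) / k.+1%:R by field; rewrite lt0r_neq0.
rewrite ger0_norm ?divr_ge0 ?subr_ge0// (le_trans _ ek)//.
rewrite ler_pdivrMr// mulVf ?lt0r_neq0// lerBlDl.
by move: xg; rewrite intrD => /ltW.
Unshelve. all: by end_near. Qed.

(* A coordinatewise sequentially continuous function is the pointwise limit of
   its values at points of finer and finer grids. *)
Lemma measurable_fun_seq_continuous m (g : m.-tuple R -> R) :
  (forall (u : nat -> m.-tuple R) (a : m.-tuple R),
    (forall i, tnth (u k) i @[k --> \oo] --> tnth a i) ->
    g (u k) @[k --> \oo] --> g a) ->
  measurable_fun [set: m.-tuple T] (g : m.-tuple T -> R).
Proof.
move=> cg.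
pose q k (a : m.-tuple T) : m.-tuple int := [tuple grid k (tnth a i) | i < m].
pose s k (z : m.-tuple int) : m.-tuple R := [tuple (tnth z i)%:~R / k.+1%:R | i < m].
apply: (@measurable_fun_cvg _ _ _ _ (fun k => (g \o s k) \o q k)).
  move=> k; apply: measurable_countable_comp => z.
  (* The fibre of [q k] over [z] is a box: each coordinate lies in a prescribed half-open cell. *)
  rewrite (_ : _ @^-1` _ = \bigcap_(i in [set: 'I_m])
    ((fun t : m.-tuple T => k.+1%:R * tnth t i) @^-1`
      `[(tnth z i)%:~R, (tnth z i + 1)%:~R[)).
    apply: fin_bigcap_measurable => // i _; rewrite -[X in measurable X]setTI.
    by apply: measurable_funM => //; exact: measurable_tnth.
  apply/seteqP; split => t.
    move=> <- i _ /=; rewrite in_itv/= tnth_mktuple.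
    exact: real_floor_itv (num_real _).
  move=> tz; apply: eq_from_tnth => i; rewrite tnth_mktuple.
  by have := tz i I; rewrite /= in_itv/=; exact: floor_def.
move=> a _; apply: cg => i.
under eq_fun do rewrite /s /q /= !tnth_mktuple.
exact: grid_cvg.
Qed.

End discretization.

Section mdist.
Variable R : realType.
Local Notation C := R[i].
Local Notation T := (measurableTypeR R).

Lemma cvg_complex (x y : nat -> R) (a b : R) :
  x k @[k --> \oo] --> a -> y k @[k --> \oo] --> b ->
  ((x k +i* y k)%C : C^o) @[k --> \oo] --> ((a +i* b)%C : C^o).
Proof.
move=> /cvgrPdist_lt xa /cvgrPdist_lt yb; apply/cvgrPdist_lt => e.
(* A positive complex number has zero imaginary part, so [e] is a real tolerance; half of it goes to
   each of the two parts, by [|z| <= |Re z| + |Im z|]. *)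
rewrite ltcE/= => /andP[/eqP eIm eRe].
have e20 : 0 < complex.Re e / 2 by rewrite divr_gt0.
near=> k.
rewrite normc_def/= ltcE/= eIm eqxx/=.
have le_sum (p q : R) : Num.sqrt (p ^+ 2 + q ^+ 2) <= `|p| + `|q|.
  rewrite -[leRHS]ger0_norm ?addr_ge0// -sqrtr_sqr ler_wsqrtr//.
  rewrite sqrrD !real_normK ?num_real//.
  by rewrite -addrA lerD2l lerDr mulrn_wge0// mulr_ge0.
rewrite (le_lt_trans (le_sum _ _))// (splitr (complex.Re e)) ltrD//.
  by near: k; exact: xa.
by near: k; exact: yb.
Unshelve. all: by end_near. Qed.

(** Carries the continuity axiom from row vectors to tuples: with finitely many entries,
    coordinatewise convergence is convergence of the row vector. *)
Lemma mdist_seq_continuous (Phi : {poly C} -> R) n (v : 'I_n -> {poly C})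
    (u : nat -> n.-tuple C) (a : n.-tuple C) :
  multiplicative_distance Phi ->
  (forall i, (tnth (u k) i : C^o) @[k --> \oo] --> (tnth a i : C^o)) ->
  Phi (\sum_(i < n) tnth (u k) i *: v i) @[k --> \oo] -->
  Phi (\sum_(i < n) tnth a i *: v i).
Proof.
move=> hPhi ua.
pose r (t : n.-tuple C) : 'rV[C^o]_n := \row_i tnth t i.
have rE t : \sum_(i < n) tnth t i *: v i =
    \sum_(i < n) (r t ord0 i : C) *: v i.
  by apply: eq_bigr => i _; rewrite mxE.
rewrite rE; under eq_fun do rewrite rE.
have ru : r (u k) @[k --> \oo] --> r a.
  move=> A [P Pa PA].
  have : \forall k \near \oo, forall i, P ord0 i (tnth (u k) i).
    apply: filter_forall => i; apply: ua; have := Pa ord0 i.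
    by rewrite mxE.
  apply: filterS => k Pk; apply: PA => i j; rewrite mxE ord1; exact: Pk.
exact: (cvg_comp _ _ ru (@mdist_continuous _ _ hPhi n v (r a))).
Qed.

End mdist.

(** * Slices of the star bodies *)

Section scaling.
Variables (R : realType) (N : nat) (Phi : {poly R[i]} -> R).
Hypothesis hPhi : multiplicative_distance Phi.
Local Notation C := R[i].
Local Notation T := (measurableTypeR R).
Local Notation mu := (@lebesgue_measure R).

Lemma measurable_Phi_vec_real : measurable_fun setT
  (fun a : N.+1.-tuple T => Phi_vec Phi (realvec a)).
Proof.
apply: measurable_fun_seq_continuous => u a ua.
apply: (mdist_seq_continuous (v := fun i : 'I_N.+1 => 'X^(N - i))
  (u := fun k => realvec (u k)) hPhi) => i.
have rE (t : N.+1.-tuple R) : tnth (realvec t) i = (tnth t i +i* 0)%C.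
  by rewrite tnth_map.
rewrite rE; under eq_fun do rewrite rE.
by apply: cvg_complex; [exact: ua|exact: cvg_cst].
Qed.

Lemma measurable_Phi_vec_complex : measurable_fun setT
  (fun a : N.+1.*2.-tuple T => Phi_vec Phi (complexvec a)).
Proof.
apply: measurable_fun_seq_continuous => u a ua.
apply: (mdist_seq_continuous (v := fun i : 'I_N.+1 => 'X^(N - i))
  (u := fun k => complexvec (u k)) hPhi) => i.
have i0 : (i.*2 < N.+1.*2)%N by rewrite ltn_double.
have i1 : (i.*2.+1 < N.+1.*2)%N by rewrite ltn_Sdouble.
have rE (t : N.+1.*2.-tuple R) : tnth (complexvec t) i =
    (tnth t (Ordinal i0) +i* tnth t (Ordinal i1))%C.
  by rewrite tnth_mktuple !(tnth_nth 0).
rewrite rE; under eq_fun do rewrite rE.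
by apply: cvg_complex; exact: ua.
Qed.

Lemma Phi_vecZ (w : C) (a : N.+1.-tuple C) :
  Phi_vec Phi [tuple of map ( *%R w) a] = Normc.normc w * Phi_vec Phi a.
Proof.
rewrite /Phi_vec -(mdistZ hPhi) /vec_poly scaler_sumr; congr Phi.
by apply: eq_bigr => i _; rewrite tnth_map scalerA.
Qed.

Lemma Phi_tildeE (b : N.-tuple C) :
  Phi_tilde Phi b = Phi_vec Phi [tuple of 1 :: b].
Proof.
rewrite /Phi_tilde /Phi_vec /monic_vec_poly /vec_poly big_ord_recl tnth0.
rewrite scale1r subn0; congr (Phi (_ + _)).
by apply: eq_bigr => i _; rewrite tnthS.
Qed.

(** The polynomial is monic, hence nonzero: its coefficient of [X^N] is 1, all other terms having
    exponent [N - (i + 1) < N]. *)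
Lemma Phi_tilde_gt0 (b : N.-tuple C) : 0 < Phi_tilde Phi b.
Proof.
rewrite lt0r (mdist_ge0 hPhi) andbT; apply/eqP => /(mdist_eq0 hPhi) b0.
have := congr1 (fun p : {poly C} => p`_N) b0.
rewrite coef0 /monic_vec_poly coefD coefXn eqxx coef_sum big1 ?addr0.
  by move/eqP; rewrite oner_eq0.
move=> i _; rewrite coefZ coefXn gtn_eqF ?mulr0//.
by rewrite ltn_subrL/= (leq_ltn_trans _ (ltn_ord i)).
Qed.

(** Dividing by the leading coefficient makes the polynomial monic; homogeneity restores the factor
    [|w|]. *)
Lemma Phi_vec_cons (w : C) (t : N.-tuple C) : w != 0 ->
  Phi_vec Phi [tuple of w :: t] =
  Normc.normc w * Phi_tilde Phi [tuple of map ( *%R w^-1) t].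
Proof.
move=> w0; rewrite Phi_tildeE -Phi_vecZ; congr Phi_vec; apply/val_inj => /=.
rewrite mulr1 -map_comp -[LHS]/(w :: val t); congr cons.
by rewrite -[LHS]map_id; apply: eq_map => z /=; rewrite mulrA divff// mul1r.
Qed.

Lemma measurable_Phi_tilde_real : measurable_fun setT
  (fun b : N.-tuple T => Phi_tilde Phi (realvec b)).
Proof.
have mc : measurable_fun setT (fun b : N.-tuple T => [tuple of (1 : T) :: b]).
  by apply: measurable_cons => //; exact: measurable_id.
have := measurableT_comp measurable_Phi_vec_real mc.
congr measurable_fun; apply/funext => b /=; rewrite Phi_tildeE; congr Phi_vec.
exact/val_inj.
Qed.

Lemma measurable_Phi_tilde_complex : measurable_fun setT
  (fun b : N.*2.-tuple T => Phi_tilde Phi (complexvec b)).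
Proof.
have m0 : measurable_fun setT
    (fun b : N.*2.-tuple T => [tuple of (0 : T) :: b]).
  by apply: measurable_cons => //; exact: measurable_id.
have mc : measurable_fun setT
    (fun b : N.*2.-tuple T => [tuple of (1 : T) :: [tuple of (0 : T) :: b]]).
  exact: (measurable_cons (measurable_cst (1 : T)) m0).
have := measurableT_comp measurable_Phi_vec_complex mc.
congr measurable_fun; apply/funext => b /=; rewrite Phi_tildeE; congr Phi_vec.
exact: complexvec_cons.
Qed.

(** The slice is the preimage of [{b | |x| Phi~(b) <= 1}] under multiplication by [x^-1], which
    dilates volume by [|x|^N]. *)
Lemma U_N_section (x : R) : x != 0 ->
  (lebesgue_tuple R N [set t : N.-tuple R | U_N N Phi [tuple of x :: t]] =
   (`|x| ^+ N)%R%:E *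
   lebesgue_tuple R N [set b | (`|x| * Phi_tilde Phi (realvec b) <= 1)%R])%E.
Proof.
move=> x0; have xV0 : x^-1 != 0 by rewrite invr_eq0.
have mA : measurable ([set b | `|x| * Phi_tilde Phi (realvec b) <= 1] :
    set (N.-tuple T)).
  apply: measurable_set_bool; apply: measurable_fun_ler => //.
  by apply: measurable_funM => //; exact: measurable_Phi_tilde_real.
have := lebesgue_tuple_scale xV0 mA.
rewrite normfV -exprVn invrK => <-; congr (lebesgue_tuple R N _).
apply/funext => t /=; rewrite /U_N /=.
have -> : realvec [tuple of x :: t] = [tuple of x%:C%C :: realvec t].
  exact/val_inj.
rewrite Phi_vec_cons; last by rewrite eq_complex/= (negbTE x0).
rewrite /= expr0n addr0 sqrtr_sqr; congr (is_true (_ * Phi_tilde _ _ <= 1)).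
apply/val_inj => /=; rewrite -!map_comp; apply: eq_map => y /=.
by rewrite -[RHS]/((x^-1 * y)%:C)%C rmorphM fmorphV.
Qed.

Lemma V_N_section (x y : R) : x != 0 ->
  (lebesgue_ctuple [set t : N.-tuple C | V_N N Phi [tuple of (x +i* y)%C :: t]] =
   (plane_norm (x, y) ^+ N.*2)%R%:E *
   lebesgue_tuple R N.*2
     [set b | (plane_norm (x, y) * Phi_tilde Phi (complexvec b) <= 1)%R])%E.
Proof.
move=> x0.
have n0 : x ^+ 2 + y ^+ 2 != 0.
  by rewrite gt_eqF// ltr_pwDl ?sqr_ge0// exprn_even_gt0.
(* [a + ib] is the inverse of [x + iy], of squared modulus [1 / (x^2 + y^2)]; its real part is
   nonzero because [x] is. *)
pose a := x / (x ^+ 2 + y ^+ 2); pose b := - y / (x ^+ 2 + y ^+ 2).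
have a0 : a != 0 by rewrite mulf_neq0// invr_neq0.
pose A := [set b : N.-tuple C | (plane_norm (x, y) * Phi_tilde Phi b <= 1)%R].
have mA : cmeasurable A.
  apply: measurable_set_bool; apply: measurable_fun_ler => //.
  by apply: measurable_funM => //; exact: measurable_Phi_tilde_complex.
have := lebesgue_ctuple_scale b a0 mA.
have -> : a ^+ 2 + b ^+ 2 = (x ^+ 2 + y ^+ 2)^-1 by rewrite /a /b; field.
rewrite -exprVn invrK.
have -> : (x ^+ 2 + y ^+ 2) ^+ N = plane_norm (x, y) ^+ N.*2.
  by rewrite -mul2n exprM sqr_sqrtr// addr_ge0 ?sqr_ge0.
rewrite {2}/lebesgue_ctuple => <-; congr lebesgue_ctuple.
apply/funext => t /=; rewrite /V_N /A /=.
have w0 : (x +i* y)%C != 0 by rewrite eq_complex/= (negbTE x0).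
have wV : ((x +i* y)%C)^-1 = (a +i* b)%C by rewrite /a /b mulNr.
by rewrite (Phi_vec_cons _ w0) wV.
Qed.

End scaling.

(** * Integration over the leading coefficient *)

Section volumes.
Variables (R : realType) (N : nat) (Phi : {poly R[i]} -> R).
Hypotheses (hPhi : multiplicative_distance Phi) (N_gt0 : (1 <= N)%N).
Local Notation C := R[i].
Local Notation T := (measurableTypeR R).
Local Notation mu := (@lebesgue_measure R).

(** The slice formulas fail to cover [x = 0]; a single point is Lebesgue null. *)
Lemma ge0_ae_neq0_eq_integral (f g : T -> \bar R) :
  measurable_fun setT f -> measurable_fun setT g ->
  (forall x, 0 <= f x)%E -> (forall x, 0 <= g x)%E ->
  (forall x, x != 0 -> f x = g x) -> (\int[mu]_x f x = \int[mu]_x g x)%E.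
Proof.
move=> mf mg f0 g0 fg; apply: ge0_ae_eq_integral => //.
exists [set 0]; split; [exact: measurable_set1|exact: lebesgue_measure_set1|].
move=> x /= /not_implyP[_ nfg]; apply: contrapT => /eqP x0.
by apply: nfg; exact: fg.
Qed.

(** The radial identity on the line: intervals [[-r, r]] have length [2 r], so [K = 2], [d = 1];
    taking [k = N] gives [s = N + 1] and the constant [K d = 2]. *)
Lemma real_volume :
  (lebesgue_tuple R N.+1 (U_N N Phi) = 2%:E * mellin (f_N N Phi) N.+1%:R)%E.
Proof.
have mnrm : measurable_fun setT (fun x : T => `|x|) by exact: measurableT_comp.
have mphi := @measurable_Phi_tilde_real R N Phi hPhi.
have ball (r : R) : 0 <= r -> mu [set x | `|x| <= r] = (2 * r ^+ 1)%:E.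
  move=> r0; rewrite (_ : mkset _ = `[- r, r]%classic); last first.
    by apply/seteqP; split => x; rewrite /= in_itv/= ler_norml.
  rewrite lebesgue_measure_itv/= lte_fin expr1; case: ifPn => [_|].
    by rewrite -EFinB opprK -mulr2n mulr_natl.
  by rewrite -leNgt => rr; rewrite (_ : r = 0) ?mulr0//; lra.
have := @radial_mellin _ _ _ _ R mu (lebesgue_tuple R N)
  (fun x : T => `|x|) (fun b => Phi_tilde Phi (realvec b)) 2 1 mnrm mphi
  (fun=> normr_ge0 _) (fun=> Phi_tilde_gt0 hPhi _) (ler0n R 2) ball N N_gt0.
rewrite mulr1 addn1 => <-.
rewrite lebesgue_tupleS; apply: ge0_ae_neq0_eq_integral.
- apply: (measurable_fun_lebesgue_tuple (A := [set p | U_N N Phi (cons_pair p)])).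
  apply: measurable_set_bool; apply: measurable_fun_ler => //.
  apply: (measurableT_comp (@measurable_Phi_vec_real R N Phi hPhi)).
  exact: measurable_cons_pair.
- apply: emeasurable_funM; first by apply/measurable_EFinP; exact: measurable_funX.
  apply: (measurable_fun_lebesgue_tuple (A :=
    [set p : T * N.-tuple T | `|p.1| * Phi_tilde Phi (realvec p.2) <= 1])).
  apply: measurable_set_bool; apply: measurable_fun_ler => //.
  apply: measurable_funM; first exact: (measurableT_comp mnrm measurable_fst).
  exact: (measurableT_comp mphi measurable_snd).
- by move=> x; exact: measure_ge0.
- by move=> x; rewrite mule_ge0// lee_fin exprn_ge0.
- by move=> x x0; rewrite U_N_section.
Qed.

(** The radial identity in the plane: disks have area [pi r^2], so [K = pi], [d = 2]; taking
    [k = 2N] gives [s = 2N + 2] and the constant [K d = 2 pi]. *)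
Lemma complex_volume :
  (lebesgue_ctuple (V_N N Phi) =
   (2 * pi)%:E * mellin (h_N N Phi) N.*2.+2%:R)%E.
Proof.
have mphi := @measurable_Phi_tilde_complex R N Phi hPhi.
have N2_gt0 : (0 < N.*2)%N by rewrite double_gt0.
have := @radial_mellin _ _ _ _ R (@plane_measure R) (lebesgue_tuple R N.*2)
  (@plane_norm R) (fun b => Phi_tilde Phi (complexvec b)) pi 2
  (@measurable_plane_norm R) mphi (fun=> sqrtr_ge0 _)
  (fun=> Phi_tilde_gt0 hPhi _) (pi_ge0 R) (@plane_ball R) N.*2 N2_gt0.
rewrite addn2 [pi * _]mulrC => <-.
pose F (z : T * T) : \bar R :=
  ((plane_norm z ^+ N.*2)%R%:E * lebesgue_tuple R N.*2
    [set b | (plane_norm z * Phi_tilde Phi (complexvec b) <= 1)%R])%E.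
have mF : measurable_fun setT F.
  apply: emeasurable_funM.
    by apply/measurable_EFinP; apply: measurable_funX; exact: measurable_plane_norm.
  apply: (measurable_fun_lebesgue_tuple (A :=
    [set p : (T * T) * N.*2.-tuple T |
      plane_norm p.1 * Phi_tilde Phi (complexvec p.2) <= 1])).
  apply: measurable_set_bool; apply: measurable_fun_ler => //.
  apply: measurable_funM.
    exact: (measurableT_comp (@measurable_plane_norm R) measurable_fst).
  exact: (measurableT_comp mphi measurable_snd).
have F0 z : (0 <= F z)%E by rewrite mule_ge0// lee_fin exprn_ge0// sqrtr_ge0.
have mV : cmeasurable (V_N N Phi).
  apply: measurable_set_bool; apply: measurable_fun_ler => //.
  exact: measurable_Phi_vec_complex.
pose G (z : T * T) : \bar R :=
  lebesgue_ctuple [set t : N.-tuple C | V_N N Phi [tuple of (z.1 +i* z.2)%C :: t]].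
have mG : measurable_fun setT G by exact: measurable_fun_lebesgue_ctuple.
have G0 z : (0 <= G z)%E by exact: measure_ge0.
(* As iterated integrals, both sides are compared through their inner integrals over [y]; these
   agree for [x != 0], which discards the line of purely imaginary leading coefficients. *)
rewrite lebesgue_ctupleS (fubini_tonelli1 F mF F0).
apply: ge0_ae_neq0_eq_integral.
- exact: (measurable_fun_fubini_tonelli_F G mG G0).
- exact: (measurable_fun_fubini_tonelli_F F mF F0).
- by move=> x; apply: integral_ge0 => y _; exact: (G0 (x, y)).
- by move=> x; apply: integral_ge0 => y _; exact: (F0 (x, y)).
- by move=> x x0; apply: eq_integral => y _; exact: V_N_section.
Qed.

End volumes.

Theorem theorem5 (R : realType) (Phi : {poly R[i]} -> R) (N : nat)
    (hPhi : multiplicative_distance Phi) (hN : (1 <= N)%N) :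
  (lebesgue_tuple R N.+1 (U_N N Phi)
     = 2%:E * mellin (f_N N Phi) (N.+1)%:R)%E /\
  (lebesgue_ctuple (V_N N Phi)
     = (2 * pi)%:E * mellin (h_N N Phi) (N.*2.+2)%:R)%E.
Proof. by split; [exact: real_volume|exact: complex_volume]. Qed.
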